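(* For $0<q<1$ the following three Hecke-type series identities hold: $$\sum_{n=0}^\infty\frac{(q;q^2)_nq^n}{(q^2;q^2)_n}=\frac{(q;q^2)_\infty}{(q^2;q^2)_\infty}\sum_{n=0}^\infty\sum_{j=-n}^n(-1)^{n+j}q^{n^2+n-j^2},$$ $$\sum_{n=0}^\infty\frac{(-1)^nq^{n^2+n}}{(q^2;q^2)_n}=\frac{1}{(q;q)_\infty}\sum_{n=0}^\infty\sum_{j=-n}^n(1-q^{2n+1})(-1)^jq^{2n^2+n-j^2},$$ $$\sum_{n=0}^\infty\frac{(-1)^nq^{n(n+1)/2}}{(q;q)_n}=\frac{(-q;q)_\infty}{(q;q)_\infty}\sum_{n=0}^\infty\sum_{j=-n}^n(-1)^j(1-q^{2n+1})q^{(3n^2+n)/2-j^2}.$$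
   Context: For $0<p<1$ put $(x;p)_0=1$, $(x;p)_n=\prod_{k=0}^{n-1}(1-xp^k)$, $(x;p)_\infty=\prod_{k\ge0}(1-xp^k)$. The double sums are read as outer sums over $n$ of the finite inner sums over $j$. *)

(* Defs.v *)
From mathcomp Require Import all_boot all_order all_algebra.
From mathcomp Require Import all_classical all_reals all_analysis.
Set Implicit Arguments.
Unset Strict Implicit.
Unset Printing Implicit Defensive.
Import Order.TTheory GRing.Theory Num.Theory.
Import numFieldNormedType.Exports.
Local Open Scope classical_set_scope.
Local Open Scope ring_scope.

Definition qpoch (R : realType) (x p : R) (n : nat) : R :=
  \prod_(k < n) (1 - x * p ^+ k).

(* [limn] is total; [is_cvg_qpoch] below shows that the limit exists whenever
   0 < p < 1. *)
Definition qpoch_inf (R : realType) (x p : R) : R := limn (qpoch x p).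

(* The sum of F j over the integers j with -n <= j <= n. *)
Definition sum_sym (R : realType) (n : nat) (F : int -> R) : R :=
  \sum_(i < n.*2.+1) F (i%:Z - n%:Z).

(* The equality sum_n u_n = c * sum_n v_n, including the convergence of both
   series, which an equation between [limn]s alone would not assert. *)
Definition series_identity (R : realType) (u : R ^nat) (c : R) (v : R ^nat)
  : Prop :=
  [/\ cvgn (series u), cvgn (series v)
    & limn (series u) = c * limn (series v)].

Lemma is_cvg_qpoch (R : realType) (x p : R) :
  0 < p < 1 -> cvgn (qpoch x p).
Proof.
move=> /andP[p0 p1].
have np1 : `|p| < 1 by rewrite gtr0_norm.
have qS n : qpoch x p n.+1 = qpoch x p n * (1 - x * p ^+ n).
  by rewrite /qpoch big_ord_recr.
have geo_le n : \sum_(k < n) `|x| * p ^+ k <= `|x| / (1 - p).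
  have -> : \sum_(k < n) `|x| * p ^+ k = series (geometric `|x| p) n.
    by rewrite /series /= big_mkord.
  rewrite geometric_seriesE ?lt_eqF//= ler_pM2r ?invr_gt0 ?subr_gt0//.
  by rewrite ler_piMr// gerBl exprn_ge0// ltW.
pose C := expR (`|x| / (1 - p)).
have q_le n : `|qpoch x p n| <= C.
  apply: (@le_trans _ _ (expR (\sum_(k < n) `|x| * p ^+ k))); last first.
    by rewrite ler_expR.
  rewrite expR_sum /qpoch normr_prod; apply: ler_prod => k _.
  rewrite normr_ge0/= (le_trans _ (expR_ge1Dx _))//.
  by rewrite (le_trans (ler_normB _ _))// normr1 normrM normrX (gtr0_norm p0).
have cvT : cvgn (series (telescope (qpoch x p))).
  apply: normed_cvg.
  apply: (@series_le_cvg _ _ (geometric (C * `|x|) p)) => [n|n|n|].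
  - exact: normr_ge0.
  - by rewrite geometric_ge0 ?mulr_ge0 ?expR_ge0// ltW.
  - rewrite /telescope /= qS mulrBr mulr1 addrAC subrr add0r normrN !normrM.
    by rewrite normrX (gtr0_norm p0) mulrA !ler_pM ?mulr_ge0 ?exprn_ge0// ltW.
  - exact: is_cvg_geometric_series.
have -> : qpoch x p =
    (fun n => qpoch x p 0 + series (telescope (qpoch x p)) n).
  by apply/funext => n; rewrite -eq_sum_telescope.
by apply: is_cvgD => //; exact: is_cvg_cst.
Qed.

(* Main.v *)
Require Import Defs.
From mathcomp Require Import all_boot all_order all_algebra.
From mathcomp Require Import all_classical all_reals all_analysis.
From mathcomp Require Import ring lra zify.
Set Implicit Arguments.
Unset Strict Implicit.
Unset Printing Implicit Defensive.
Import Order.TTheory GRing.Theory Num.Theory.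
Import numFieldNormedType.Exports.
Local Open Scope classical_set_scope.
Local Open Scope ring_scope.

(** All three identities come from one Bailey pair. Put
    alpha_r = (1 - q^(2r+1)) q^(r^2) sum_(|j| <= r) (-1)^j q^(-j^2). Then
      sum_(r <= n) alpha_r / ((q;q)_(n-r) (q;q)_(n+r+1)) = (-1)^n / (q^2;q^2)_n
    ([hecke_bailey_pair]): the weight of the inner sum is a telescoping
    difference, summation by parts makes the powers of q cancel, and Gauss's
    alternating sum of q-binomial coefficients ([gauss_alt_sum_even]) remains.

    Multiply by a weight delta_n and sum over n. After interchanging the sums, the
    coefficient of alpha_r is
      sum_(n >= r) delta_n / ((q;q)_(n-r) (q;q)_(n+r+1)).
    For delta_n a product of the quadratic factors p - b q^k + q^(2k+2) this is a
    q-Gauss series ([q_gauss]), hence an explicit infinite product. The q-Gauss sum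
    is proved by a contiguity relation in its lower parameter c: shifting c to c q
    pulls out one factor of the product, and the series tends to 1 as c tends
    to 0. The interchange is Tannery's theorem ([tannery]): alpha_r is bounded and
    delta_n decays geometrically. The result is [hecke_expansion], and the choices
    (p, b) = (-q, 0), (0, 0), (0, -q) give the three identities. *)

(** * Finite q-shifted factorials *)

Lemma qpochS (R : realType) (x p : R) n :
  qpoch x p n.+1 = qpoch x p n * (1 - x * p ^+ n).
Proof. by rewrite /qpoch big_ord_recr. Qed.

Lemma qpoch0 (R : realType) (x p : R) : qpoch x p 0 = 1.
Proof. by rewrite /qpoch big_ord0. Qed.

Lemma qpochD (R : realType) (x p : R) m n :
  qpoch x p (m + n) = qpoch x p m * qpoch (x * p ^+ m) p n.
Proof.
elim: n => [|n IHn]; first by rewrite addn0 qpoch0 mulr1.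
by rewrite addnS !qpochS IHn exprD !mulrA.
Qed.

Lemma qpoch_gt0 (R : realType) (x p : R) n :
  0 < p < 1 -> x < 1 -> 0 < qpoch x p n.
Proof.
move=> /andP[p0 p1] x1; apply: prodr_gt0 => k _; rewrite subr_gt0.
have [x0|x0] := leP x 0.
  by apply: (le_lt_trans _ ltr01); rewrite mulr_le0_ge0// exprn_ge0// ltW.
by apply: (le_lt_trans _ x1); rewrite ler_piMr ?exprn_ile1// ltW.
Qed.

Lemma qpoch_neq0 (R : realType) (q : R) n : 0 < q < 1 -> qpoch q q n != 0.
Proof. by move=> hq; rewrite gt_eqF// qpoch_gt0//; case/andP: hq. Qed.

Lemma qpoch_dissect (R : realType) (q : R) n :
  qpoch q q n * qpoch (- q) q n = qpoch (q ^+ 2) (q ^+ 2) n.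
Proof.
rewrite /qpoch -big_split; apply: eq_bigr => k _ /=.
by rewrite -exprM mulnC exprM; ring.
Qed.

(** * The Bailey pair *)

(** Up to the factor (q;q)_n this is Gauss's alternating sum of the q-binomial
    coefficients n choose k; dividing by (q;q)_n turns a factor 1 - q^k into an
    index shift. *)
Definition gauss_alt_sum (R : realType) (q : R) n : R :=
  \sum_(k < n.+1) (-1) ^+ k / (qpoch q q k * qpoch q q (n - k)).

(** Write g_n for the sum and D_n for the same sum with the k-th term multiplied
    by q^k. Since (1 - q^k) / (q;q)_k = 1 / (q;q)_(k-1), dropping the factor
    1 - q^k shifts an index: this gives g_(n+1) - D_(n+1) = - g_n, and with
    1 - q^n = (1 - q^k) + q^k (1 - q^(n-k)) also
    (1 - q^(n+1)) g_(n+1) = D_n - g_n. Eliminating D leaves the recurrence. *)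
Lemma gauss_alt_sum_rec (R : realType) (q : R) n : 0 < q < 1 ->
  (1 - q ^+ n.+2) * gauss_alt_sum q n.+2 = gauss_alt_sum q n.
Proof.
move=> hq.
pose g := gauss_alt_sum q.
pose D m := \sum_(k < m.+1) (-1) ^+ k * q ^+ k / (qpoch q q k * qpoch q q (m - k)).
have nz m := qpoch_neq0 m hq.
have fnz m : 1 - q ^+ m.+1 != 0.
  by have := nz m.+1; rewrite qpochS mulf_eq0 negb_or exprS => /andP[].
have E1 m : g m.+1 - D m.+1 = - g m.
  rewrite /g /gauss_alt_sum /D -sumrB big_ord_recl /= !expr0 mulr1 subrr add0r -sumrN.
  apply: eq_bigr => i _; rewrite /bump /= add1n subSS qpochS -exprS.
  rewrite [(-1) ^+ i.+1]exprS.
  by have := nz i; have := nz (m - i)%N; have := fnz i => ? ? ?; field; apply/and3P.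
have E2 m : (1 - q ^+ m.+1) * g m.+1 = - g m + D m.
  rewrite -E1.
  have -> : D m = \sum_(k < m.+2) (-1) ^+ k * q ^+ k * (1 - q ^+ (m.+1 - k))
                    / (qpoch q q k * qpoch q q (m.+1 - k)).
    rewrite [RHS]big_ord_recr /= subnn expr0 subrr mulr0 mul0r addr0.
    apply: eq_bigr => i _; rewrite subSn ?qpochS -?exprS; last by rewrite -ltnS.
    by have := nz i; have := nz (m - i)%N; have := fnz (m - i)%N => ? ? ?;
      field; apply/and3P.
  rewrite /g /gauss_alt_sum /D -sumrB -big_split mulr_sumr; apply: eq_bigr => i _ /=.
  have {1}-> : q ^+ m.+1 = q ^+ i * q ^+ (m.+1 - i).
    by rewrite -exprD subnKC// -ltnS.
  by have := nz i; have := nz (m.+1 - i)%N => ? ?; field; apply/andP.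
rewrite -/(g n.+2) E2 -/(g n).
have -> : D n.+1 = g n.+1 + g n by rewrite -[g n]opprK -E1; ring.
by ring.
Qed.

Lemma gauss_alt_sum_even (R : realType) (q : R) n : 0 < q < 1 ->
  gauss_alt_sum q n.*2 = (qpoch (q ^+ 2) (q ^+ 2) n)^-1.
Proof.
move=> hq; elim: n => [|n IHn].
  by rewrite /gauss_alt_sum big_ord_recl big_ord0 /= !qpoch0 expr0 mul1r mulr1 addr0.
have q21 : 0 < q ^+ 2 < 1.
  by case/andP: hq => q0 q1; rewrite exprn_gt0//= exprn_ilt1 ?ltW.
have nz m : qpoch (q ^+ 2) (q ^+ 2) m != 0 by exact: qpoch_neq0.
have := nz n.+1; rewrite qpochS mulf_eq0 negb_or -exprS -exprM mul2n doubleS.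
move=> /andP[_ fnz].
apply: (mulfI fnz); rewrite gauss_alt_sum_rec// IHn.
by have := nz n => ?; field; apply/andP.
Qed.

Lemma sum_symS (R : realType) n (F : int -> R) :
  sum_sym n.+1 F = F (- n.+1%:Z) + sum_sym n F + F n.+1%:Z.
Proof.
rewrite /sum_sym doubleS big_ord_recl big_ord_recr /= addrA; congr (_ + _ + _).
- by congr F; rewrite sub0r.
- by apply: eq_bigr => i _; congr F; rewrite /bump /=; lia.
- by congr F; rewrite /bump /=; lia.
Qed.

Lemma sum_sym0 (R : realType) (F : int -> R) : sum_sym 0 F = F 0.
Proof. by rewrite /sum_sym big_ord_recl big_ord0 addr0 /= subrr. Qed.

Lemma sum_symZ (R : realType) n (c : R) (F : int -> R) :
  sum_sym n (fun j => c * F j) = c * sum_sym n F.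
Proof. by rewrite /sum_sym mulr_sumr. Qed.

Lemma eq_sum_sym (R : realType) n (F G : int -> R) :
  (forall j, F j = G j) -> sum_sym n F = sum_sym n G.
Proof. by move=> FG; apply: eq_bigr. Qed.

(** Abel summation for sums over symmetric intervals: F j occurs in the r-th term
    exactly when |j| <= r, and the differences of U then telescope from |j|. *)
Lemma sum_sym_by_parts (R : realType) (U : nat -> R) (F : int -> R) n :
  \sum_(r < n.+1) (U r - U r.+1) * sum_sym r F
  = sum_sym n (fun j => F j * (U `|j|%N - U n.+1)).
Proof.
elim: n => [|n IHn].
  by rewrite big_ord_recl big_ord0 !sum_sym0 /=; ring.
rewrite big_ord_recr IHn /= !sum_symS abszN absz_nat.
have -> : sum_sym n (fun j => F j * (U `|j|%N - U n.+1)) =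
   sum_sym n (fun j => F j * (U `|j|%N - U n.+2)) - (U n.+1 - U n.+2) * sum_sym n F.
  rewrite -sum_symZ /sum_sym -sumrB; apply: eq_bigr => i _; ring.
ring.
Qed.

Lemma expNz_sqr (R : realType) (q : R) (m : nat) :
  q ^ (- m%:Z ^+ 2) = (q ^+ (m ^ 2))^-1.
Proof. by rewrite exprnN; congr (_ ^ _); lia. Qed.

(** The sequence alpha_r of the Bailey pair, without its factor 1 - q^(2r+1): that
    factor cancels in one of the three identities. *)
Definition hecke_inner (R : realType) (q : R) r : R :=
  q ^+ (r ^ 2) * sum_sym r (fun j => (-1) ^ j * q ^ (- j ^+ 2)).

(** The source of the indefinite form n^2 - j^2. The coefficient of the symmetric
    sum over j in the r-th term is a difference U_r - U_(r+1) with
    U_r = q^(r^2) / ((q;q)_(n-r) (q;q)_(n+r)), so Abel summation leaves the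
    j-sum of (-1)^j q^(-j^2) U_|j|: the powers of q cancel, and what remains is
    Gauss's alternating sum of length 2n. *)
Lemma hecke_bailey_pair (R : realType) (q : R) n : 0 < q < 1 ->
  \sum_(r < n.+1) (1 - q ^+ (2 * r + 1)) * hecke_inner q r
     / (qpoch q q (n - r) * qpoch q q (n + r).+1)
  = (-1) ^+ n / qpoch (q ^+ 2) (q ^+ 2) n.
Proof.
move=> hq; have /andP[q0 q1] := hq.
have nz m := qpoch_neq0 m hq.
have fnz m : 1 - q ^+ m.+1 != 0.
  by have := nz m.+1; rewrite qpochS mulf_eq0 negb_or exprS => /andP[].
(* Cutting U off after n makes the top term r = n telescope as well. *)
pose U r := if (r <= n)%N then q ^+ (r ^ 2) / (qpoch q q (n - r) * qpoch q q (n + r))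
            else 0.
pose F (j : int) := (-1) ^ j * q ^ (- j ^+ 2) : R.
transitivity (\sum_(r < n.+1) (U r - U r.+1) * sum_sym r F).
  apply: eq_bigr => -[r /= rn] _; rewrite ltnS in rn.
  rewrite /hecke_inner -/F mulrA mulrAC; congr (_ * _).
  rewrite /U rn; case: (ltngtP r n) rn => // [rn|->] _.
    have -> : (n - r = (n - r.+1).+1)%N by lia.
    rewrite !(addnS n r) !qpochS -!exprS.
    have -> : q ^+ (r.+1 ^ 2) = q ^+ (r ^ 2) * q ^+ (2 * r + 1).
      by rewrite -exprD; congr (_ ^+ _); lia.
    have -> : q ^+ (n + r).+1 = q ^+ (n - r.+1).+1 * q ^+ (2 * r + 1).
      by rewrite -exprD; congr (_ ^+ _); lia.
    have := fnz (n + r)%N.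
    have -> : q ^+ (n + r).+1 = q ^+ (n - r.+1).+1 * q ^+ (2 * r + 1).
      by rewrite -exprD; congr (_ ^+ _); lia.
    have := fnz (n - r.+1)%N; have := nz (n - r.+1)%N; have := nz (n + r)%N.
    by move=> ? ? ? ?; field; apply/and4P.
  rewrite subnn subr0 addnn qpoch0 qpochS -exprS -addnn.
  have := fnz (n + n)%N; have := nz (n + n)%N.
  have -> : (2 * n + 1 = (n + n).+1)%N by lia.
  by move=> ? ?; field; apply/andP.
rewrite sum_sym_by_parts {2}/U ltnn /=.
rewrite -gauss_alt_sum_even// /gauss_alt_sum mulr_sumr; apply: eq_bigr => -[i /= i2n] _.
rewrite subr0 /F.
have sgn : (-1 : R) ^ (i%:Z - n%:Z) = (-1) ^+ n * (-1) ^+ i.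
  rewrite expfzDr ?oppr_eq0 ?oner_neq0// mulrC -exprnP; congr (_ * _).
  by rewrite -invr_expz -exprnP -exprVn invrN1.
rewrite sgn -!mulrA; congr (_ * (_ * _)).
have [ni|ni] := leqP n i.
  rewrite subzn// absz_nat /U ifT; last by lia.
  have -> : (n - (i - n) = n.*2 - i)%N by lia.
  have -> : (n + (i - n) = i)%N by lia.
  rewrite mulrA.
  have -> : q ^ (- (i - n)%N%:Z ^+ 2) * q ^+ ((i - n) ^ 2) = 1.
    by rewrite expNz_sqr mulVf// gt_eqF// exprn_gt0.
  by rewrite mul1r mulrC.
have -> : i%:Z - n%:Z = - (n - i)%N%:Z by lia.
rewrite abszN absz_nat sqrrN /U ifT; last by lia.
have -> : (n + (n - i) = n.*2 - i)%N by lia.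
have -> : (n - (n - i) = i)%N by lia.
rewrite mulrA.
have -> : q ^ (- (n - i)%N%:Z ^+ 2) * q ^+ ((n - i) ^ 2) = 1.
  by rewrite expNz_sqr mulVf// gt_eqF// exprn_gt0.
by rewrite mul1r.
Qed.

(** The terms q^(r^2-j^2) are of size one near j = r, so a bound uniform in r
    comes from the recursion h_(r+1) = q^(2r+1) h_r + 2 (-1)^(r+1), which keeps
    |h| below the fixed point of h = q h + 2. *)
Lemma hecke_inner_bound (R : realType) (q : R) r : 0 < q < 1 ->
  `|hecke_inner q r| <= 2 / (1 - q).
Proof.
move=> /andP[q0 q1].
elim: r => [|r IHr].
  rewrite /hecke_inner sum_sym0 expNz_sqr !expr0z !expr0 invr1 !mul1r normr1.
  by rewrite ler_pdivlMr; lra.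
have -> : hecke_inner q r.+1 = q ^+ (2 * r + 1) * hecke_inner q r + 2 * (-1) ^+ r.+1.
  rewrite /hecke_inner sum_symS sqrrN.
  have E : q ^+ (r.+1 ^ 2) * q ^ (- r.+1%:Z ^+ 2) = 1.
    by rewrite expNz_sqr mulfV// gt_eqF// exprn_gt0.
  have -> : (-1 : R) ^ (- r.+1%:Z) = (-1) ^+ r.+1.
    by rewrite -invr_expz -exprnP -exprVn invrN1.
  rewrite -exprnP.
  transitivity (q ^+ (r.+1 ^ 2) * sum_sym r (fun j => (-1) ^ j * q ^ (- j ^+ 2))
     + 2 * (-1) ^+ r.+1 * (q ^+ (r.+1 ^ 2) * q ^ (- r.+1%:Z ^+ 2))); first by ring.
  rewrite E mulr1 mulrA -exprD; congr (_ ^+ _ * _ + _); lia.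
move: (hecke_inner q r) IHr => y IHr.
apply: (le_trans (ler_normD _ _)).
rewrite !normrM !normrX normrN1 expr1n mulr1 (gtr0_norm q0) normr_nat.
have h : q ^+ (2 * r + 1) * `|y| <= q * (2 / (1 - q)).
  apply: ler_pM => //; first by rewrite exprn_ge0// ltW.
  by rewrite addn1 exprS ler_piMr ?exprn_ile1// ltW.
have E2 : q * (2 / (1 - q)) + 2 = 2 / (1 - q).
  by field; rewrite subr_eq0 gt_eqF.
by rewrite -E2 lerD2r.
Qed.

(** * Limits of sums and of infinite products *)

(** Tannery's theorem with a growing range of summation: a summable majorant makes
    the tails uniformly small, so the limit may be taken term by term. *)
Lemma tannery (R : realType) (f : nat -> nat -> R) (g M : nat -> R) :
  cvgn (series M) -> (forall N r, `|f N r| <= M r) ->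
  (forall r, f ^~ r @ \oo --> g r) ->
  cvgn (series g) /\ (fun N => \sum_(r < N) f N r) @ \oo --> limn (series g).
Proof.
move=> cM fM fg.
have gM r : `|g r| <= M r.
  by apply: (cvgr_to_le (cvg_norm (fg r))); near=> N; exact: fM.
have M0 r : 0 <= M r by apply: le_trans (gM r).
have cg : cvgn (series g).
  by apply: normed_cvg; apply: (@series_le_cvg _ _ M) => // r; exact: normr_ge0.
split=> //.
suff H : (fun N => \sum_(r < N) (f N r - g r)) @ \oo --> (0 : R).
  have -> : (fun N => \sum_(r < N) f N r) =
      (fun N => \sum_(r < N) (f N r - g r) + series g N).
    by apply/funext => N; rewrite /series /= big_mkord -big_split;
       apply: eq_bigr => r _ /=; rewrite subrK.
  by rewrite -[limn _]add0r; apply: cvgD.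
apply/cvgr0Pnorm_lt => e e0.
have e4 : 0 < e / 4 by rewrite divr_gt0.
have [K _ HK] : \forall K \near \oo, `|limn (series M) - series M K| < e / 4.
  exact: (cvgrPdist_lt _ _).1 cM _ e4.
have Mnd : {homo series M : a b / (a <= b)%N >-> a <= b}.
  by apply/nondecreasing_seqP => n; rewrite /series /= big_nat_recr//= lerDl.
have head : \forall N \near \oo, `|\sum_(r < K) (f N r - g r)| < e / 4.
  have : (fun N => \sum_(r < K) (f N r - g r)) @ \oo --> (0 : R).
    rewrite [X in _ --> X](_ : 0 = \sum_(r < K) (g r - g r)); last first.
      by rewrite big1// => r _; rewrite subrr.
    apply: (@cvg_big _ _ +%R 0 xpredT add_continuous) => r _.
    by apply: cvgB => //; exact: cvg_cst.
  by move/cvgr0Pnorm_lt; exact.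
near=> N.
have KN : (K <= N)%N by near: N; exact: nbhs_infty_ge.
rewrite -(big_mkord xpredT (fun r => f N r - g r)) (@big_cat_nat _ _ _ K)//= big_mkord.
apply: (le_lt_trans (ler_normD _ _)).
have tail : `|\sum_(K <= r < N) (f N r - g r)| <= 2 * (series M N - series M K).
  rewrite sub_series_geq// mulr_sumr; apply: (le_trans (ler_norm_sum _ _ _)).
  by apply: ler_sum => r _; rewrite mulr2n mulrDl !mul1r;
     apply: (le_trans (ler_normB _ _)); exact: lerD.
have limN : series M N <= limn (series M) by exact: nondecreasing_cvgn_le.
have := HK K (leqnn K); rewrite /= ltr_norml => /andP[_ HKK].
have hN : `|\sum_(r < K) (f N r - g r)| < e / 4 by near: N.
by lra.
Unshelve. all: by end_near. Qed.

Lemma qpoch_inf_le (R : realType) (x p : R) n :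
  0 < p < 1 -> 0 <= x < 1 -> qpoch_inf x p <= qpoch x p n.
Proof.
move=> hp /andP[x0 x1]; have /andP[p0 p1] := hp.
apply: nonincreasing_cvgn_ge; last exact: is_cvg_qpoch.
apply/nonincreasing_seqP => m; rewrite qpochS ler_piMr ?(ltW (qpoch_gt0 _ _ _))//.
by rewrite gerBl mulr_ge0// exprn_ge0// ltW.
Qed.

(** Nonvanishing of the infinite product. For 0 < x < 1 each factor is bounded
    below through 1 - x t >= exp (- x t / (1 - x)) for 0 <= t <= 1, and the
    exponents form a geometric series. *)
Lemma qpoch_inf_gt0 (R : realType) (x p : R) :
  0 < p < 1 -> x < 1 -> 0 < qpoch_inf x p.
Proof.
move=> hp x1; have /andP[p0 p1] := hp.
have cv := @is_cvg_qpoch R x p hp.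
have [x0|x0] := leP x 0.
  apply: (lt_le_trans ltr01); apply: limr_ge => //; near=> n.
  rewrite /qpoch; elim/big_ind: _ => // [a b a1 b1|k _].
    by rewrite -[1]mulr1 ler_pM.
  by rewrite lerBrDl gerDr mulr_le0_ge0// exprn_ge0// ltW.
(* 1 - x t and 1 / (1 + y t) agree at t = 1. *)
pose y := x / (1 - x).
have y0 : 0 <= y by rewrite divr_ge0// ?subr_ge0 ltW.
have factor_ge k : expR (- (y * p ^+ k)) <= 1 - x * p ^+ k.
  have pk0 : 0 < p ^+ k by rewrite exprn_gt0.
  have pk1 : p ^+ k <= 1 by rewrite exprn_ile1// ltW.
  have f0 : 0 < 1 - x * p ^+ k.
    by rewrite subr_gt0; apply: le_lt_trans x1; rewrite ler_piMr// ltW.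
  rewrite expRN -[leRHS]invrK lef_pV2 ?posrE ?expR_gt0 ?invr_gt0//.
  apply: le_trans (expR_ge1Dx _).
  rewrite invf_ple ?posrE//; last by rewrite ltr_pwDl// mulr_ge0// ltW.
  rewrite -div1r ler_pdivrMr; last by rewrite ltr_pwDl// mulr_ge0// ltW.
  have -> : (1 - x * p ^+ k) * (1 + y * p ^+ k) =
     1 + x ^+ 2 / (1 - x) * (p ^+ k * (1 - p ^+ k)).
    by rewrite /y; field; rewrite subr_eq0 gt_eqF.
  rewrite lerDl mulr_ge0 ?divr_ge0 ?mulr_ge0 ?exprn_ge0 ?subr_ge0//; exact: ltW.
apply: (lt_le_trans (expR_gt0 (- (y / (1 - p))))).
apply: limr_ge => //; near=> n.
apply: (@le_trans _ _ (expR (\sum_(k < n) - (y * p ^+ k)))).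
  rewrite ler_expR sumrN lerN2.
  have -> : \sum_(k < n) y * p ^+ k = series (geometric y p) n.
    by rewrite /series /= big_mkord.
  rewrite geometric_seriesE ?lt_eqF//= ler_pM2r ?invr_gt0 ?subr_gt0//.
  by rewrite ler_piMr// gerBl exprn_ge0// ltW.
rewrite expR_sum /qpoch; apply: ler_prod => k _.
by rewrite expR_ge0/= factor_ge.
Unshelve. all: by end_near. Qed.

Lemma qpoch_bounded (R : realType) (x p : R) : 0 < p < 1 ->
  exists K, forall n, `|qpoch x p n| <= K.
Proof.
move=> hp; have /cvg_seq_bounded[B [_ HB]] := @is_cvg_qpoch R x p hp.
by exists (B + 1) => n; apply: (HB (B + 1)) => //; rewrite ltrDl.
Qed.

(** The quadratic factors are multiples of (u - q^k)(v - q^k): written by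
    their coefficients, they cover parameters tending to infinity (u = 0) and
    conjugate square roots (u = -v) uniformly. *)
Definition quad_prod (R : realType) (q a b d : R) n : R :=
  \prod_(k < n) (a - b * q ^+ k + d * q ^+ k ^+ 2).

Lemma quad_prodS (R : realType) (q a b d : R) n :
  quad_prod q a b d n.+1 = quad_prod q a b d n * (a - b * q ^+ n + d * q ^+ n ^+ 2).
Proof. by rewrite /quad_prod big_ord_recr. Qed.

Lemma quad_prod0 (R : realType) (q a b d : R) : quad_prod q a b d 0 = 1.
Proof. by rewrite /quad_prod big_ord0. Qed.

Lemma quad_prodD (R : realType) (q a b d : R) m n :
  quad_prod q a b d (m + n) =
  quad_prod q a b d m * quad_prod q a (b * q ^+ m) (d * q ^+ m ^+ 2) n.
Proof.
elim: n => [|n IHn]; first by rewrite addn0 quad_prod0 mulr1.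
by rewrite addnS !quad_prodS IHn -mulrA exprD exprMn !mulrA.
Qed.

Lemma quad_prod_dilate (R : realType) (q a b d z : R) n :
  quad_prod q (a * z) (b * z) (d * z) n = z ^+ n * quad_prod q a b d n.
Proof.
elim: n => [|n IHn]; first by rewrite !quad_prod0 mul1r.
by rewrite !quad_prodS IHn (exprS z); ring.
Qed.

(** The k-th factor is at most lam (1 + x q^k) with x = (|b| + |d|) / lam, and the
    product of the 1 + x q^k converges. *)
Lemma quad_prod_bound (R : realType) (q a b d lam : R) :
  0 < q < 1 -> `|a| <= lam -> 0 < lam ->
  exists2 K, 0 <= K & forall n, `|quad_prod q a b d n| <= K * lam ^+ n.
Proof.
move=> hq al l0; have /andP[q0 q1] := hq.
have [K HK] := qpoch_bounded (- ((`|b| + `|d|) / lam)) hq.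
exists K => [|n]; first exact: le_trans (HK 0%N).
apply: (@le_trans _ _ (qpoch (- ((`|b| + `|d|) / lam)) q n * lam ^+ n)); last first.
  by rewrite ler_pM2r ?exprn_gt0// (le_trans _ (HK n))// ler_norm.
have -> : lam ^+ n = \prod_(k < n) lam by rewrite prodr_const card_ord.
rewrite /quad_prod /qpoch normr_prod -big_split; apply: ler_prod => k _ /=.
rewrite normr_ge0/=.
have -> : (1 - - ((`|b| + `|d|) / lam) * q ^+ k) * lam
          = lam + `|b| * q ^+ k + `|d| * q ^+ k.
  by field; rewrite gt_eqF.
have qk0 : 0 <= q ^+ k by rewrite exprn_ge0// ltW.
have qk1 : q ^+ k <= 1 by rewrite exprn_ile1// ltW.
apply: (le_trans (ler_normD _ _)); apply: lerD.
  apply: (le_trans (ler_normB _ _)); apply: lerD => //.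
  by rewrite normrM (ger0_norm qk0).
rewrite normrM (ger0_norm (sqr_ge0 _)); apply: ler_wpM2l => //.
by rewrite expr2 ler_piMl.
Qed.

(** * The q-Gauss sum *)

Lemma dominating_ratio (R : realType) (p : R) :
  `|p| < 1 -> exists2 lam, 0 < lam < 1 & `|p| <= lam.
Proof.
move=> p1; have p0 := normr_ge0 p; exists ((1 + `|p|) / 2); last by lra.
by apply/andP; split; lra.
Qed.

Lemma sum_geometric_le (R : realType) (z : R) n :
  0 <= z < 1 -> \sum_(k < n) z ^+ k <= (1 - z)^-1.
Proof.
move=> /andP[z0 z1].
have -> : \sum_(k < n) z ^+ k = series (geometric 1 z) n.
  by rewrite /series /= big_mkord; apply: eq_bigr => k _; rewrite mul1r.
rewrite geometric_seriesE ?lt_eqF//= mul1r; apply: ler_piMl.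
  by rewrite invr_ge0 subr_ge0 ltW.
by rewrite gerBl exprn_ge0.
Qed.

(** With p = c u v and s = c (u + v) this is the general term of the series
    2phi1(1/u, 1/v; c; q, c u v). *)
Definition gauss_term (R : realType) (q p s c : R) m : R :=
  quad_prod q p s c m / (qpoch q q m * qpoch c q m).

Lemma gauss_term_bound (R : realType) (q p s c lam : R) :
  0 < q < 1 -> `|p| <= lam -> 0 < lam -> 0 <= c < 1 ->
  exists2 K, 0 <= K & forall m, `|gauss_term q p s c m| <= K * lam ^+ m.
Proof.
move=> hq pl l0 hc; have /andP[q0 q1] := hq; have /andP[c0 c1] := hc.
have [K K0 HK] := quad_prod_bound s c hq pl l0.
have e1 := qpoch_inf_gt0 hq q1; have e2 := qpoch_inf_gt0 hq c1.
exists (K / (qpoch_inf q q * qpoch_inf c q)) => [|m].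
  by rewrite divr_ge0// mulr_ge0// ltW.
have q1m : 0 < qpoch q q m by exact: qpoch_gt0.
have q2m : 0 < qpoch c q m by exact: qpoch_gt0.
rewrite /gauss_term normrM normfV (gtr0_norm (mulr_gt0 q1m q2m)) mulrAC.
apply: ler_pM => //; first by rewrite invr_ge0 mulr_ge0// ltW.
rewrite lef_pV2 ?posrE ?mulr_gt0//.
by apply: ler_pM; rewrite ?(ltW e1) ?(ltW e2)//; apply: qpoch_inf_le => //; rewrite ?(ltW q0).
Qed.

Lemma cvg_gauss_series (R : realType) (q p s c : R) :
  0 < q < 1 -> `|p| < 1 -> 0 <= c < 1 -> cvgn (series (gauss_term q p s c)).
Proof.
move=> hq p1 hc; have /andP[q0 q1] := hq.
have [lam /andP[lam0 lam1] pl] := dominating_ratio p1.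
have [K K0 HK] := gauss_term_bound s hq pl lam0 hc.
apply: normed_cvg; apply: (@series_le_cvg _ _ (geometric K lam)) => // [n|n|].
- exact: normr_ge0.
- by rewrite /= mulr_ge0// exprn_ge0// ltW.
- by apply: is_cvg_geometric_series; rewrite gtr0_norm.
Qed.

(** The contiguity relation shifting c to c q with u and v fixed: the combination
    of the two general terms is, up to the factor 1 - c, the difference of
    consecutive values of (1 - q^m) T_m, which vanishes at m = 0 and in the
    limit. *)
Lemma gauss_contiguous (R : realType) (q p s c : R) :
  0 < q < 1 -> `|p| < 1 -> 0 <= c < 1 ->
  (1 - c) * (1 - p) * limn (series (gauss_term q p s c)) =
  (1 - s + c * p) * limn (series (gauss_term q (p * q) (s * q) (c * q))).
Proof.
move=> hq p1 hc; have /andP[q0 q1] := hq; have /andP[c0 c1] := hc.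
have cT := cvg_gauss_series (s := s) hq p1 hc.
have cT' : cvgn (series (gauss_term q (p * q) (s * q) (c * q))).
  apply: cvg_gauss_series => //.
    by rewrite normrM (gtr0_norm q0) (le_lt_trans _ p1)// ler_piMr// ltW.
  by rewrite mulr_ge0 ?(ltW q0)//= (le_lt_trans _ c1)// ler_piMr// ltW.
pose T := gauss_term q p s c; pose T' := gauss_term q (p * q) (s * q) (c * q).
have nzq m : 1 - q ^+ m.+1 != 0.
  by rewrite subr_eq0 gt_eqF// exprn_ilt1// ltW.
have nzc m : 1 - c * q ^+ m != 0.
  rewrite subr_eq0 gt_eqF//; apply: le_lt_trans c1.
  by rewrite ler_piMr// exprn_ile1// ltW.
have tele m : (1 - c) * (1 - p) * T m - (1 - s + c * p) * T' m =
    (1 - c) * ((1 - q ^+ m) * T m - (1 - q ^+ m.+1) * T m.+1).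
  rewrite /T /T' /gauss_term quad_prod_dilate quad_prodS !qpochS -exprS.
  have nz1 : qpoch q q m != 0 by exact: qpoch_neq0.
  have nz2 : qpoch c q m != 0 by rewrite gt_eqF// qpoch_gt0.
  have nz0 : 1 - c != 0 by rewrite subr_eq0 gt_eqF.
  have -> : qpoch (c * q) q m = qpoch c q m * (1 - c * q ^+ m) / (1 - c).
    rewrite -qpochS -[in RHS]add1n qpochD expr1 qpochS qpoch0 mul1r expr0 mulr1.
    by rewrite mulrAC divff// mul1r.
  move: (nzq m) (nzc m) => h1 h2.
  by rewrite exprS; field; rewrite -?exprS; apply/and5P; split.
have partial M : (1 - c) * (1 - p) * series T M - (1 - s + c * p) * series T' M =
    - (1 - c) * ((1 - q ^+ M) * T M).
  rewrite /series /= !mulr_sumr -sumrB (eq_bigr _ (fun m _ => tele m)) -mulr_sumr.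
  rewrite (@telescope_sumr_eq _ _ _ (fun m => - ((1 - q ^+ m) * T m)))// => [|m _].
    by rewrite expr0; ring.
  by ring.
suff /cvg_lim : (fun M => (1 - c) * (1 - p) * series T M - (1 - s + c * p) * series T' M)
   @ \oo --> (0 : R).
  move=> /(_ (@Rhausdorff R)) E.
  apply/eqP; rewrite -subr_eq0 -E; apply/eqP/esym/cvg_lim; first exact: Rhausdorff.
  by apply: cvgB; apply: cvgMl_tmp.
rewrite (_ : (fun M => _) = (fun M => - (1 - c) * ((1 - q ^+ M) * T M))); last first.
  by apply/funext.
rewrite -[0 in X in _ --> X](mulr0 (- (1 - c))); apply: cvgMl_tmp.
rewrite -[0 in X in _ --> X](mulr0 (1 - 0)); apply: cvgM; last exact: cvg_series_cvg_0.
apply: cvgB; first exact: cvg_cst.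
by apply: cvg_expr; rewrite gtr0_norm.
Qed.

(** The m-th term at c q^N is at most q^(N m) times the m-th term at c, so all
    terms but the first vanish in the limit, uniformly enough to sum. *)
Lemma gauss_sum_dilate (R : realType) (q p s c : R) :
  0 < q < 1 -> `|p| < 1 -> 0 <= c < 1 ->
  (fun N => limn (series (gauss_term q (p * q ^+ N) (s * q ^+ N) (c * q ^+ N))))
    @ \oo --> (1 : R).
Proof.
move=> hq p1 hc; have /andP[q0 q1] := hq; have /andP[c0 c1] := hc.
have [lam /andP[lam0 lam1] pl] := dominating_ratio p1.
have [K K0 HK] := gauss_term_bound s hq pl lam0 hc.
have near1 N : `|limn (series (gauss_term q (p * q ^+ N) (s * q ^+ N) (c * q ^+ N))) - 1|
    <= q ^+ N * (K / (1 - lam)).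
  set z := q ^+ N.
  have z0 : 0 <= z by rewrite exprn_ge0// ltW.
  have z1 : z <= 1 by rewrite exprn_ile1// ltW.
  have cz : 0 <= c * z < 1.
    by rewrite mulr_ge0//= (le_lt_trans _ c1)// ler_piMr.
  have pz : `|p * z| < 1.
    by rewrite normrM (ger0_norm z0) (le_lt_trans _ p1)// ler_piMr.
  have cv := cvg_gauss_series (s := s * z) hq pz cz.
  have term m : `|gauss_term q (p * z) (s * z) (c * z) m.+1| <= z * (K * lam ^+ m).
    have b : `|gauss_term q (p * z) (s * z) (c * z) m.+1| <=
        z ^+ m.+1 * `|gauss_term q p s c m.+1|.
      rewrite /gauss_term quad_prod_dilate !normrM !normfV -mulrA normrX (ger0_norm z0).
      apply: ler_wpM2l; first exact: exprn_ge0.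
      apply: ler_wpM2l => //.
      have d1 : 0 < qpoch q q m.+1 by exact: qpoch_gt0.
      have d2 : 0 < qpoch c q m.+1 by exact: qpoch_gt0.
      have d3 : 0 < qpoch (c * z) q m.+1 by apply: qpoch_gt0 => //; case/andP: cz.
      rewrite !gtr0_norm ?mulr_gt0// lef_pV2 ?posrE ?mulr_gt0// ler_pM2l//.
      apply: ler_prod => k _; have qk : 0 <= q ^+ k by rewrite exprn_ge0// ltW.
      have qk1 : q ^+ k <= 1 by rewrite exprn_ile1// ltW.
      rewrite subr_ge0 lerD2l lerN2 (le_trans _ (ltW c1)) ?ler_piMr//=.
      by rewrite ler_wpM2r// ler_piMr.
    apply: (le_trans b); apply: ler_pM; [exact: exprn_ge0|exact: normr_ge0| |].
      by rewrite exprS ler_piMr// exprn_ile1.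
    apply: (le_trans (HK _)); apply: ler_wpM2l => //.
    by rewrite exprS ler_piMl// ?exprn_ge0// ltW.
  have cv1 : (fun M => `|series (gauss_term q (p * z) (s * z) (c * z)) M - 1|) @ \oo
      --> `|limn (series (gauss_term q (p * z) (s * z) (c * z))) - 1|.
    by apply: cvg_norm; apply: cvgB; [exact: cv|exact: cvg_cst].
  apply: (cvgr_to_le cv1); near=> M.
  have -> : M = M.-1.+1 by rewrite prednK//; near: M; exact: nbhs_infty_gt.
  rewrite /= /series /= big_mkord big_ord_recl {1}/gauss_term quad_prod0 !qpoch0.
  rewrite mulr1 divr1 addrAC subrr add0r; apply: (le_trans (ler_norm_sum _ _ _)).
  apply: (@le_trans _ _ (\sum_(i < M.-1) z * (K * lam ^+ i))).
    by apply: ler_sum => i _; exact: term.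
  rewrite -!mulr_sumr; apply: ler_wpM2l => //; apply: ler_wpM2l => //.
  by apply: sum_geometric_le; rewrite (ltW lam0).
rewrite -subr_cvg0; apply: norm_cvg0.
apply: (@squeeze_cvgr _ _ _ _ (cst 0) (fun N => q ^+ N * (K / (1 - lam)))).
- by near=> N; rewrite normr_ge0 near1.
- exact: cvg_cst.
- rewrite -[0 in X in _ --> X](mul0r (K / (1 - lam))); apply: cvgMr_tmp.
  by apply: cvg_expr; rewrite gtr0_norm.
Unshelve. all: by end_near. Qed.

(** The q-Gauss summation: iterating the contiguity relation N times extracts N
    factors of the product and leaves a series that tends to 1. *)
Lemma q_gauss (R : realType) (q p s c L : R) :
  0 < q < 1 -> `|p| < 1 -> 0 <= c < 1 ->
  (fun N => quad_prod q 1 s (c * p) N / (qpoch c q N * qpoch p q N)) @ \oo --> L ->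
  series (gauss_term q p s c) @ \oo --> L.
Proof.
move=> hq p1 hc PL; have /andP[q0 q1] := hq; have /andP[c0 c1] := hc.
have cv := cvg_gauss_series (s := s) hq p1 hc.
pose G N := limn (series (gauss_term q (p * q ^+ N) (s * q ^+ N) (c * q ^+ N))).
pose P N := quad_prod q 1 s (c * p) N / (qpoch c q N * qpoch p q N).
have PG N : G 0%N = P N * G N.
  elim: N => [|N ->].
    by rewrite /P quad_prod0 !qpoch0 mulr1 divr1 mul1r.
  have qN0 : 0 <= q ^+ N by rewrite exprn_ge0// ltW.
  have qN1 : q ^+ N <= 1 by rewrite exprn_ile1// ltW.
  have pN : `|p * q ^+ N| < 1.
    by rewrite normrM (ger0_norm qN0) (le_lt_trans _ p1)// ler_piMr.
  have cN : 0 <= c * q ^+ N < 1.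
    by rewrite mulr_ge0//= (le_lt_trans _ c1)// ler_piMr.
  have := gauss_contiguous (s * q ^+ N) hq pN cN.
  rewrite -/(G N) -!mulrA -!exprSr -/(G N.+1) => E.
  have nzc : 1 - c * q ^+ N != 0 by rewrite subr_eq0 gt_eqF//; case/andP: cN.
  have nzp : 1 - p * q ^+ N != 0.
    by rewrite subr_eq0 gt_eqF// (le_lt_trans _ pN)// ler_norm.
  have nz1 : qpoch c q N != 0 by rewrite gt_eqF// qpoch_gt0.
  have nz2 : qpoch p q N != 0.
    by rewrite gt_eqF// qpoch_gt0// (le_lt_trans _ p1)// ler_norm.
  have {}E : G N = (1 - s * q ^+ N + c * p * q ^+ N ^+ 2) * G N.+1
               / ((1 - c * q ^+ N) * (1 - p * q ^+ N)).
    apply: (mulfI (mulf_neq0 nzc nzp)); rewrite -mulrA E.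
    by field; apply/andP.
  by rewrite E /P quad_prodS !qpochS; field; apply/and4P.
have lim1 : (fun N => P N * G N) @ \oo --> L * 1.
  by apply: cvgM; [exact: PL|exact: gauss_sum_dilate].
have -> : L = limn (series (gauss_term q p s c)); last by [].
rewrite -[L]mulr1 -(cvg_lim (@Rhausdorff R) lim1).
rewrite (_ : (fun N => P N * G N) = cst (G 0%N)); last by apply/funext => N; rewrite -PG.
by rewrite lim_cst// /G expr0 !mulr1.
Qed.

(** * Transfer through the Bailey pair *)

(** The conjugate half of the transfer: reindexed by n = r + m, the series is
    a multiple of a q-Gauss series with c = q^(2r+2). The numerator of its product
    is the tail of the limit L from the r-th factor on, and (q^(2r+2);q)_oo
    combines with (q;q)_(2r+1) to (q;q)_oo. *)
Lemma conjugate_bailey_pair (R : realType) (q p b L : R) r :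
  0 < q < 1 -> `|p| < 1 ->
  (forall n, quad_prod q 1 b (p * q ^+ 2) n != 0) ->
  quad_prod q 1 b (p * q ^+ 2) @ \oo --> L ->
  series (fun m => quad_prod q p b (q ^+ 2) (r + m) /
                   (qpoch q q m * qpoch q q ((r + r).+1 + m))) @ \oo -->
  quad_prod q p b (q ^+ 2) r / quad_prod q 1 b (p * q ^+ 2) r
    * (L / (qpoch_inf q q * qpoch_inf p q)).
Proof.
move=> hq p1 nzT TL; have /andP[q0 q1] := hq.
set delta := quad_prod q p b (q ^+ 2); set Theta := quad_prod q 1 b (p * q ^+ 2) in nzT TL *.
pose c := q ^+ 2 * q ^+ r ^+ 2.
have cE : c = q * q ^+ (r + r).+1.
  by rewrite /c -exprM -exprD -exprS; congr (_ ^+ _); lia.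
have hc : 0 <= c < 1.
  by rewrite cE -exprS exprn_ge0 ?(ltW q0)//= exprn_ilt1// ltW.
have nzq := qpoch_neq0 _ hq.
have -> : (fun m => delta (r + m)%N / (qpoch q q m * qpoch q q ((r + r).+1 + m))) =
    (fun m => delta r / qpoch q q (r + r).+1 * gauss_term q p (b * q ^+ r) c m).
  apply/funext => m; rewrite /gauss_term /delta quad_prodD qpochD -cE -/c.
  have nzc : qpoch c q m != 0 by rewrite gt_eqF// qpoch_gt0//; case/andP: hc.
  have := nzq (r + r).+1; have := nzq m => h1 h2.
  by field; apply/and3P.
have -> : delta r / Theta r * (L / (qpoch_inf q q * qpoch_inf p q)) =
  delta r / qpoch q q (r + r).+1 *
   ((L / Theta r) / ((qpoch_inf q q / qpoch q q (r + r).+1) * qpoch_inf p q)).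
  have h1 : qpoch_inf q q != 0 by rewrite gt_eqF// qpoch_inf_gt0.
  have h2 : qpoch_inf p q != 0.
    by rewrite gt_eqF// qpoch_inf_gt0// (le_lt_trans (ler_norm _)).
  have := nzq (r + r).+1; have := nzT r => h3 h4.
  by field; apply/and4P.
have seriesZ (k : R) (u : R ^nat) : series (fun m => k * u m) = (fun N => k * series u N).
  by apply/funext => N; rewrite /series /= mulr_sumr.
rewrite seriesZ; apply: cvgMl_tmp; apply: q_gauss => //.
rewrite (_ : (fun N => _) = (fun N => Theta (N + r)%N / Theta r /
   (qpoch q q (N + (r + r).+1) / qpoch q q (r + r).+1 * qpoch p q N))); last first.
  apply/funext => N; rewrite ![(N + _)%N]addnC /Theta quad_prodD qpochD -cE.
  rewrite (_ : p * q ^+ 2 * q ^+ r ^+ 2 = c * p); last by rewrite /c; ring.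
  have nz1 : qpoch p q N != 0.
    by rewrite gt_eqF// qpoch_gt0// (le_lt_trans (ler_norm _)).
  have nz2 : qpoch c q N != 0 by rewrite gt_eqF// qpoch_gt0//; case/andP: hc.
  have := nzq (r + r).+1; have := nzT r => h1 h2; rewrite -/Theta.
  by field; apply/and4P.
apply: cvgM.
  apply: cvgMr_tmp; rewrite (cvg_shiftn r Theta); exact: TL.
apply: cvgV.
  rewrite mulf_neq0 ?mulf_neq0 ?invr_eq0 ?nzq//.
    by rewrite gt_eqF// qpoch_inf_gt0.
  by rewrite gt_eqF// qpoch_inf_gt0// (le_lt_trans (ler_norm _)).
apply: cvgM; last exact: is_cvg_qpoch.
apply: cvgMr_tmp; rewrite (cvg_shiftn _ (qpoch q q)); exact: is_cvg_qpoch.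
Qed.

Lemma sum_triangle (R : nmodType) (a : nat -> nat -> R) N :
  \sum_(n < N) \sum_(r < n.+1) a n r = \sum_(r < N) \sum_(m < N - r) a (r + m)%N r.
Proof.
elim: N => [|N IHN]; first by rewrite !big_ord0.
rewrite big_ord_recr IHN /= [RHS]big_ord_recr /= subSnn big_ord1 addn0.
rewrite [X in _ + X]big_ord_recr /= addrA -big_split /=; congr (_ + _).
apply: eq_bigr => r _; rewrite subSn ?(ltnW (ltn_ord r))// big_ord_recr /=.
by rewrite subnKC// (ltnW (ltn_ord r)).
Qed.

(** The Bailey transform for an arbitrary quadratic weight. Replace beta_n by its
    expansion in the alpha_r and interchange the sums; the inner sum is the
    q-Gauss series of [conjugate_bailey_pair]. The r-th term of the interchanged
    sum is bounded by a multiple of lam^r uniformly in the truncation N, because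
    alpha_r is bounded and the weight decays geometrically. *)
Lemma hecke_expansion (R : realType) (q p b L : R) :
  0 < q < 1 -> `|p| < 1 ->
  (forall n, quad_prod q 1 b (p * q ^+ 2) n != 0) ->
  quad_prod q 1 b (p * q ^+ 2) @ \oo --> L -> L != 0 ->
  series_identity
    (fun n => quad_prod q p b (q ^+ 2) n
              * ((-1) ^+ n / qpoch (q ^+ 2) (q ^+ 2) n))
    (L / (qpoch_inf q q * qpoch_inf p q))
    (fun n => quad_prod q p b (q ^+ 2) n / quad_prod q 1 b (p * q ^+ 2) n
              * ((1 - q ^+ (2 * n + 1)) * hecke_inner q n)).
Proof.
move=> hq p1 nzT TL L0; have /andP[q0 q1] := hq.
set delta := quad_prod q p b (q ^+ 2); set Theta := quad_prod q 1 b (p * q ^+ 2) in nzT TL *.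
set C := L / _.
have C0 : C != 0.
  rewrite mulf_neq0// invr_neq0// mulf_neq0// gt_eqF// qpoch_inf_gt0//.
  by rewrite (le_lt_trans (ler_norm _)).
pose alpha n := (1 - q ^+ (2 * n + 1)) * hecke_inner q n.
pose w r m := delta (r + m)%N / (qpoch q q m * qpoch q q ((r + r).+1 + m)).
pose f N r := alpha r * \sum_(m < N - r) w r m.
pose g r := alpha r * (delta r / Theta r * C).
have [lam /andP[lam0 lam1] pl] := dominating_ratio p1.
have [K K0 HK] := quad_prod_bound b (q ^+ 2) hq pl lam0.
pose e := qpoch_inf q q; have e0 : 0 < e by exact: qpoch_inf_gt0.
have e_le n : e <= qpoch q q n by apply: qpoch_inf_le => //; rewrite (ltW q0).
have nzq n : 0 < qpoch q q n by exact: qpoch_gt0.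
pose M := 2 / (1 - q) * (K / (e * e) / (1 - lam)).
have wb r m : `|w r m| <= K / (e * e) * lam ^+ r * lam ^+ m.
  rewrite /w normrM normfV -mulrA -exprD mulrAC.
  rewrite (gtr0_norm (mulr_gt0 (nzq _) (nzq _))).
  apply: ler_pM => //; first by rewrite invr_ge0 mulr_ge0// ltW.
  by rewrite lef_pV2 ?posrE ?mulr_gt0//; apply: ler_pM => //; exact: ltW.
have fM N r : `|f N r| <= M * lam ^+ r.
  rewrite /f /M normrM -mulrA; apply: ler_pM => //.
    rewrite /alpha normrM -[leRHS]mul1r; apply: ler_pM => //.
      rewrite ger0_norm ?subr_ge0 ?exprn_ile1// ?(ltW q0) ?(ltW q1)//.
      by rewrite gerBl exprn_ge0// ltW.
    exact: hecke_inner_bound.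
  apply: (le_trans (ler_norm_sum _ _ _)).
  apply: (@le_trans _ _ (\sum_(m < N - r) K / (e * e) * lam ^+ r * lam ^+ m)).
    by apply: ler_sum => m _; exact: wb.
  rewrite -mulr_sumr [leRHS]mulrAC; apply: ler_wpM2l.
    by rewrite mulr_ge0 ?divr_ge0 ?mulr_ge0 ?exprn_ge0// ltW.
  by apply: sum_geometric_le; rewrite (ltW lam0).
have fg r : f ^~ r @ \oo --> g r.
  apply: cvgMl_tmp.
  have := @conjugate_bailey_pair R q p b L r hq p1 nzT TL.
  rewrite -/delta -/Theta -/C -(cvg_centern r) => H.
  rewrite (_ : (fun N => _) = (fun N => series (w r) (N - r)%N)); first exact: H.
  by apply/funext => N; rewrite /series /= big_mkord.
have cM : cvgn (series (fun r => M * lam ^+ r)).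
  by apply: (@is_cvg_geometric_series _ M); rewrite gtr0_norm.
have [cg fs] := tannery cM fM fg.
have uE : series (fun n => delta n * ((-1) ^+ n / qpoch (q ^+ 2) (q ^+ 2) n)) =
   (fun N => \sum_(r < N) f N r).
  apply/funext => N; rewrite /series /= big_mkord.
  pose a n r := delta n * (alpha r / (qpoch q q (n - r) * qpoch q q (n + r).+1)).
  transitivity (\sum_(n < N) \sum_(r < n.+1) a n r).
    apply: eq_bigr => n _; rewrite -hecke_bailey_pair// mulr_sumr.
    by apply: eq_bigr => r _; rewrite /a mulrA.
  rewrite sum_triangle; apply: eq_bigr => r _; rewrite /f mulr_sumr.
  apply: eq_bigr => m _; rewrite /a /w addKn.
  rewrite (_ : (r + m + r).+1 = ((r + r).+1 + m)%N); last by rewrite addSn addnAC.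
  by ring.
have gE : series g = (fun N => C * series (fun n => delta n / Theta n * alpha n) N).
  by apply/funext => N; rewrite /series /= mulr_sumr; apply: eq_bigr => n _; rewrite /g; ring.
have cv : cvgn (series (fun n => delta n / Theta n * alpha n)).
  rewrite (_ : series _ = (fun N => C^-1 * series g N)); last first.
    by apply/funext => N; rewrite gE mulrA mulVf// mul1r.
  by apply/cvg_ex; exists (C^-1 * limn (series g)); apply: cvgMl_tmp.
split => //; first by rewrite uE; apply/cvg_ex; exists (limn (series g)).
rewrite uE (cvg_lim (@Rhausdorff R) fs) gE.
by apply: cvg_lim; [exact: Rhausdorff|apply: cvgMl_tmp].
Qed.

(** * The three specialisations *)

Lemma series_identity_scale (R : realType) (u v : R ^nat) (c k : R) :
  k != 0 -> series_identity u c (fun n => k * v n) -> series_identity u (c * k) v.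
Proof.
move=> k0 [cu cv E].
have kE : series (fun n => k * v n) = (fun N => k * series v N).
  by apply/funext => N; rewrite /series /= mulr_sumr.
have cv' : cvgn (series v).
  rewrite (_ : series v = (fun N => k^-1 * series (fun n => k * v n) N)).
    by apply/cvg_ex; eexists; apply: cvgMl_tmp; exact: cv.
  by apply/funext => N; rewrite kE mulrA mulVf// mul1r.
split=> //; rewrite E -mulrA; congr (_ * _).
by rewrite kE; apply: cvg_lim; [exact: Rhausdorff|exact: cvgMl_tmp].
Qed.

Lemma expz_subr_sqr (R : realType) (q : R) (m : nat) (a x : int) :
  q != 0 -> a = m%:Z -> q ^ (a - x) = q ^+ m * q ^ (- x).
Proof. by move=> q0 ->; rewrite expfzDr// -exprnP. Qed.

Lemma qpoch_inf_dissect (R : realType) (q : R) : 0 < q < 1 ->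
  qpoch_inf q q * qpoch_inf (- q) q = qpoch_inf (q ^+ 2) (q ^+ 2).
Proof.
move=> hq; apply/esym/cvg_lim; first exact: Rhausdorff.
rewrite (_ : qpoch (q ^+ 2) (q ^+ 2) = (fun n => qpoch q q n * qpoch (- q) q n)).
  by apply: cvgM; exact: is_cvg_qpoch.
by apply/funext => n; rewrite qpoch_dissect.
Qed.

Lemma qpoch_inf0 (R : realType) (q : R) : qpoch_inf 0 q = 1.
Proof.
apply: cvg_lim; first exact: Rhausdorff.
rewrite (_ : qpoch 0 q = cst 1); first exact: cvg_cst.
by apply/funext => n; rewrite /qpoch big1// => k _; rewrite mul0r subr0.
Qed.

(** Here p = -q and b = 0: the weight is (-q)^n (q;q^2)_n, and the product is
    (q^3;q^2)_n, which lacks the first factor of (q;q^2)_(n+1). The ratio of the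
    two cancels the factor 1 - q^(2n+1) of the Bailey pair. *)
Lemma hecke_quotient_series (R : realType) (q : R) : 0 < q < 1 ->
  series_identity
        (fun n => qpoch q (q ^+ 2) n * q ^+ n / qpoch (q ^+ 2) (q ^+ 2) n)
        (qpoch_inf q (q ^+ 2) / qpoch_inf (q ^+ 2) (q ^+ 2))
        (fun n => sum_sym n (fun j =>
           (-1) ^ (n%:Z + j) * q ^ (n%:Z ^+ 2 + n%:Z - j ^+ 2))).
Proof.
move=> hq; have /andP[q0 q1] := hq.
have hq2 : 0 < q ^+ 2 < 1 by rewrite exprn_gt0//= exprn_ilt1// ltW.
have q10 : 1 - q != 0 by rewrite subr_eq0 gt_eqF.
have dE n : quad_prod q (- q) 0 (q ^+ 2) n = (- q) ^+ n * qpoch q (q ^+ 2) n.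
  elim: n => [|n IHn]; first by rewrite quad_prod0 qpoch0 mulr1.
  by rewrite quad_prodS IHn qpochS (exprS (- q)) -!exprM mulnC; ring.
have tE n : quad_prod q 1 0 (- q * q ^+ 2) n = qpoch q (q ^+ 2) n.+1 / (1 - q).
  elim: n => [|n IHn]; first by rewrite quad_prod0 qpochS qpoch0 expr0 mulr1 mul1r divff.
  by rewrite quad_prodS IHn [in RHS]qpochS (exprS (q ^+ 2)) -!exprM mulnC; ring.
have nz n : qpoch q (q ^+ 2) n != 0 by rewrite gt_eqF// qpoch_gt0.
have := @hecke_expansion R q (- q) 0 (qpoch_inf q (q ^+ 2) / (1 - q)) hq.
rewrite normrN (gtr0_norm q0) => /(_ q1) H.
have {H} : series_identity
    (fun n => qpoch q (q ^+ 2) n * q ^+ n / qpoch (q ^+ 2) (q ^+ 2) n)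
    (qpoch_inf q (q ^+ 2) / (1 - q) / (qpoch_inf q q * qpoch_inf (- q) q))
    (fun n => (1 - q) * sum_sym n (fun j =>
           (-1) ^ (n%:Z + j) * q ^ (n%:Z ^+ 2 + n%:Z - j ^+ 2))).
  have -> : (fun n => qpoch q (q ^+ 2) n * q ^+ n / qpoch (q ^+ 2) (q ^+ 2) n) =
      (fun n => quad_prod q (- q) 0 (q ^+ 2) n
                * ((-1) ^+ n / qpoch (q ^+ 2) (q ^+ 2) n)).
    apply/funext => n; rewrite dE [(- q) ^+ n]exprNn.
    have s : (-1 : R) ^+ n * (-1) ^+ n = 1 by rewrite -expr2 sqrr_sign.
    transitivity (((-1 : R) ^+ n * (-1) ^+ n) *
       (qpoch q (q ^+ 2) n * q ^+ n / qpoch (q ^+ 2) (q ^+ 2) n)); last by ring.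
    by rewrite s mul1r.
  have -> : (fun n => (1 - q) * sum_sym n (fun j =>
           (-1) ^ (n%:Z + j) * q ^ (n%:Z ^+ 2 + n%:Z - j ^+ 2))) =
     (fun n => quad_prod q (- q) 0 (q ^+ 2) n / quad_prod q 1 0 (- q * q ^+ 2) n
              * ((1 - q ^+ (2 * n + 1)) * hecke_inner q n)).
    apply/funext => n; rewrite dE tE.
    have -> : sum_sym n (fun j => (-1) ^ (n%:Z + j) * q ^ (n%:Z ^+ 2 + n%:Z - j ^+ 2))
        = (- q) ^+ n * hecke_inner q n.
      rewrite /hecke_inner mulrA -sum_symZ; apply: eq_sum_sym => j.
      rewrite expfzDr ?oppr_eq0 ?oner_eq0// -exprnP.
      rewrite (@expz_subr_sqr _ _ (n ^ 2 + n)%N) ?gt_eqF//.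
      by rewrite exprD [(- q) ^+ n]exprNn; ring.
    have oddE : q * (q ^+ 2) ^+ n = q ^+ (2 * n + 1) by rewrite -exprM -exprS addn1.
    rewrite qpochS oddE.
    have h1 : 1 - q ^+ (2 * n + 1) != 0.
      by rewrite subr_eq0 gt_eqF// addn1 exprn_ilt1// ltW.
    have := nz n => h2.
    by field; apply/and3P.
  apply: H => [n||].
  - by rewrite tE mulf_neq0 ?invr_eq0.
  - rewrite (_ : quad_prod _ _ _ _ = (fun n => qpoch q (q ^+ 2) (n + 1) / (1 - q))).
      by apply: cvgMr_tmp; rewrite (cvg_shiftn _ (qpoch _ _)); exact: is_cvg_qpoch.
    by apply/funext => n; rewrite tE addn1.
  - by rewrite mulf_neq0 ?invr_eq0// gt_eqF// qpoch_inf_gt0.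
move=> /(series_identity_scale q10); rewrite qpoch_inf_dissect//.
rewrite (_ : _ * (1 - q) = qpoch_inf q (q ^+ 2) / qpoch_inf (q ^+ 2) (q ^+ 2))//.
have h : qpoch_inf (q ^+ 2) (q ^+ 2) != 0.
  by rewrite gt_eqF// qpoch_inf_gt0//; case/andP: hq2.
by field; apply/andP.
Qed.

(** Here p = b = 0: the weight is q^(n^2+n), and the product is trivial. *)
Lemma hecke_euler_series_sq (R : realType) (q : R) : 0 < q < 1 ->
      series_identity
        (fun n => (-1) ^+ n * q ^+ (n ^ 2 + n) / qpoch (q ^+ 2) (q ^+ 2) n)
        (1 / qpoch_inf q q)
        (fun n => sum_sym n (fun j =>
           (1 - q ^+ (2 * n + 1)) * (-1) ^ j
           * q ^ (2 * n%:Z ^+ 2 + n%:Z - j ^+ 2))).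
Proof.
move=> hq; have /andP[q0 q1] := hq.
have dE n : quad_prod q 0 0 (q ^+ 2) n = q ^+ (n ^ 2 + n).
  elim: n => [|n IHn]; first by rewrite quad_prod0.
  rewrite quad_prodS IHn mul0r subr0 add0r -exprM -!exprD; congr (_ ^+ _); lia.
have tE n : quad_prod q 1 0 (0 * q ^+ 2) n = 1.
  by rewrite /quad_prod big1// => k _; rewrite !mul0r subr0 addr0.
have := @hecke_expansion R q 0 0 1 hq.
rewrite normr0 qpoch_inf0 mulr1 => /(_ ltr01) H.
have -> : (fun n => (-1) ^+ n * q ^+ (n ^ 2 + n) / qpoch (q ^+ 2) (q ^+ 2) n) =
   (fun n => quad_prod q 0 0 (q ^+ 2) n * ((-1) ^+ n / qpoch (q ^+ 2) (q ^+ 2) n)).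
  by apply/funext => n; rewrite dE mulrAC [RHS]mulrC.
have -> : (fun n => sum_sym n (fun j => (1 - q ^+ (2 * n + 1)) * (-1) ^ j
           * q ^ (2 * n%:Z ^+ 2 + n%:Z - j ^+ 2))) =
   (fun n => quad_prod q 0 0 (q ^+ 2) n / quad_prod q 1 0 (0 * q ^+ 2) n
              * ((1 - q ^+ (2 * n + 1)) * hecke_inner q n)).
  apply/funext => n; rewrite dE tE divr1 /hecke_inner !mulrA -sum_symZ.
  apply: eq_sum_sym => j.
  rewrite (@expz_subr_sqr _ _ (n ^ 2 + n + n ^ 2)%N) ?gt_eqF//; last by lia.
  by rewrite !exprD; ring.
apply: H => [n||]; rewrite ?tE ?oner_eq0//.
rewrite (_ : quad_prod _ _ _ _ = cst 1); first exact: cvg_cst.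
by apply/funext => n; rewrite tE.
Qed.

(** Here p = 0 and b = -q: the weight is q^(n(n+1)/2) (-q;q)_n, and the product is
    (-q;q)_n, so only the power of q survives in the ratio. *)
Lemma hecke_euler_series (R : realType) (q : R) : 0 < q < 1 ->
      series_identity
        (fun n => (-1) ^+ n * q ^+ ((n * (n + 1)) %/ 2) / qpoch q q n)
        (qpoch_inf (- q) q / qpoch_inf q q)
        (fun n => sum_sym n (fun j =>
           (-1) ^ j * (1 - q ^+ (2 * n + 1))
           * q ^ (((3 * n ^ 2 + n) %/ 2)%:Z - j ^+ 2))).
Proof.
move=> hq; have /andP[q0 q1] := hq.
have Nq1 : - q < 1 by rewrite (lt_trans _ ltr01)// oppr_lt0.
have dE n : quad_prod q 0 (- q) (q ^+ 2) n =
    q ^+ ((n * (n + 1)) %/ 2) * qpoch (- q) q n.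
  elim: n => [|n IHn]; first by rewrite quad_prod0 qpoch0 mulr1.
  have -> : ((n.+1 * (n.+1 + 1)) %/ 2 = (n * (n + 1)) %/ 2 + n.+1)%N by nia.
  by rewrite quad_prodS IHn qpochS exprD (exprS _ n); ring.
have tE : quad_prod q 1 (- q) (0 * q ^+ 2) = qpoch (- q) q.
  apply/funext => n; rewrite /quad_prod /qpoch; apply: eq_bigr => k _.
  by rewrite !mul0r addr0.
have nz n : qpoch (- q) q n != 0 by rewrite gt_eqF// qpoch_gt0.
have := @hecke_expansion R q 0 (- q) (qpoch_inf (- q) q) hq.
rewrite normr0 qpoch_inf0 mulr1 tE => /(_ ltr01) H.
have -> : (fun n => (-1) ^+ n * q ^+ ((n * (n + 1)) %/ 2) / qpoch q q n) =
   (fun n => quad_prod q 0 (- q) (q ^+ 2) n * ((-1) ^+ n / qpoch (q ^+ 2) (q ^+ 2) n)).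
  apply/funext => n; rewrite dE -qpoch_dissect.
  have := nz n; have := qpoch_neq0 n hq => h1 h2.
  by field; apply/andP.
have -> : (fun n => sum_sym n (fun j => (-1) ^ j * (1 - q ^+ (2 * n + 1))
           * q ^ (((3 * n ^ 2 + n) %/ 2)%:Z - j ^+ 2))) =
   (fun n => quad_prod q 0 (- q) (q ^+ 2) n / qpoch (- q) q n
              * ((1 - q ^+ (2 * n + 1)) * hecke_inner q n)).
  apply/funext => n; rewrite dE mulfK// /hecke_inner !mulrA -sum_symZ.
  apply: eq_sum_sym => j.
  rewrite (@expz_subr_sqr _ _ ((n * (n + 1)) %/ 2 + n ^ 2)%N) ?gt_eqF//; last by congr Posz; nia.
  by rewrite !exprD; ring.
apply: H => //.
  exact: is_cvg_qpoch.
by rewrite gt_eqF// qpoch_inf_gt0.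
Qed.

Theorem proposition1p11 (R : realType) (q : R) (hq : 0 < q < 1) :
  [/\ series_identity
        (fun n => qpoch q (q ^+ 2) n * q ^+ n / qpoch (q ^+ 2) (q ^+ 2) n)
        (qpoch_inf q (q ^+ 2) / qpoch_inf (q ^+ 2) (q ^+ 2))
        (fun n => sum_sym n (fun j =>
           (-1) ^ (n%:Z + j) * q ^ (n%:Z ^+ 2 + n%:Z - j ^+ 2))),
      series_identity
        (fun n => (-1) ^+ n * q ^+ (n ^ 2 + n) / qpoch (q ^+ 2) (q ^+ 2) n)
        (1 / qpoch_inf q q)
        (fun n => sum_sym n (fun j =>
           (1 - q ^+ (2 * n + 1)) * (-1) ^ j
           * q ^ (2 * n%:Z ^+ 2 + n%:Z - j ^+ 2)))
    & series_identity
        (fun n => (-1) ^+ n * q ^+ ((n * (n + 1)) %/ 2) / qpoch q q n)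
        (qpoch_inf (- q) q / qpoch_inf q q)
        (fun n => sum_sym n (fun j =>
           (-1) ^ j * (1 - q ^+ (2 * n + 1))
           * q ^ (((3 * n ^ 2 + n) %/ 2)%:Z - j ^+ 2)))].
Proof.
split; [exact: hecke_quotient_series|exact: hecke_euler_series_sq|].
exact: hecke_euler_series.
Qed.
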